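(* Let $f \colon \mathbb{R}^n \to \mathbb{R}$, $g \colon \mathbb{R}^n \to \mathbb{R}^m$, $h \colon \mathbb{R}^n \to \mathbb{R}^p$ be continuously differentiable, let $\rho > 0$, and let $p^\rho(y) = \sum_{i=1}^n p_i^\rho(y_i)$ with each $p_i^\rho$ satisfying (P.1)--(P.3) stated in the context. Let $(x^*,y^* )$ be a stationary point of (SPOcp): $\min_{x,y} f(x) + p^\rho(y)$ s.t. $g(x) \le 0$, $h(x) = 0$, $x \circ y = 0$, $x \ge 0$, $y \ge 0$, such that SP-MFCQ holds at $x^*$. Then there exist an $\alpha^* > 0$ and a neighborhood $U$ of $(x^*,y^* )$ such that, for all $\alpha \ge \alpha^*$, every stationary point of (Pen($\alpha$)): $\min_{x,y} f(x) + p^\rho(y) + \alpha x^T y$ s.t. $g(x) \le 0$, $h(x) = 0$, $x \ge 0$, $y \ge 0$ in $U$ is a stationary point of (SPOcp).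
   Context: Notation: $x \circ y$ is the componentwise product; $I_0(x) := \{ i \mid x_i = 0\}$; $I_g(x) := \{ i \mid g_i(x) = 0\}$; $e_i$ is the $i$-th unit vector of $\mathbb{R}^n$. ''Stationary point'' means KKT point of the respective nonlinear program (feasible, and satisfying the standard KKT conditions with some Lagrange multipliers; in (SPOcp) the $n$ constraints $x_i y_i = 0$ are treated as equality constraints). Conditions on $p_i^\rho \colon \mathbb{R} \to \mathbb{R}$: (P.1) $p_i^\rho$ is convex and attains a unique minimum at some point $s_i^\rho > 0$; (P.2) $p_i^\rho(0) - p_i^\rho(s_i^\rho) = \rho$; (P.3) $p_i^\rho$ is continuously differentiable. SP-MFCQ (sparse MFCQ) holds at $x^*$ if the gradients $\nabla g_i(x^* )$ ($i \in I_g(x^* )$), $\nabla h_j(x^* )$ ($j=1,\dots,p$), $e_i$ ($i \in I_0(x^* )$) are positively linearly independent, i.e. $\sum_{i \in I_g(x^* )} \lambda_i \nabla g_i(x^* ) + \sum_{j=1}^p \mu_j \nabla h_j(x^* ) + \sum_{i \in I_0(x^* )} \gamma_i e_i = 0$ with $\lambda_i \ge 0$ and $\mu_j, \gamma_i \in \mathbb{R}$ implies that all coefficients vanish. *)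

(* Defs.v *)
From HB Require Import structures.
From mathcomp Require Import all_boot all_order all_algebra.
From mathcomp Require Import all_classical all_reals all_analysis.

Set Implicit Arguments.
Unset Strict Implicit.
Unset Printing Implicit Defensive.

Import Order.TTheory GRing.Theory Num.Theory.
Import numFieldNormedType.Exports.
Local Open Scope ring_scope.

Section Smoothness.
Context {R : realType}.

Definition grad n (F : 'rV[R]_n -> R) (x : 'rV[R]_n) : 'rV[R]_n :=
  \row_i 'D_(delta_mx 0 i) F x.

Definition component n m (G : 'rV[R]_n -> 'rV[R]_m) (i : 'I_m) : 'rV[R]_n -> R :=
  fun x => G x 0 i.

Definition C1 n (F : 'rV[R]_n -> R) : Prop :=
  (forall x, differentiable F x) /\ continuous (grad F).

Definition C1_vec n m (G : 'rV[R]_n -> 'rV[R]_m) : Prop :=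
  forall i, C1 (component G i).

End Smoothness.

Section NonlinearPrograms.
Context {R : realType}.

(* min obj z  s.t.  ineq z <= 0 (componentwise),  eqc z = 0 *)
Record nlp (N M K : nat) := Nlp {
  obj : 'rV[R]_N -> R;
  ineq : 'rV[R]_N -> 'rV[R]_M;
  eqc : 'rV[R]_N -> 'rV[R]_K }.

Definition feasible N M K (P : nlp N M K) (z : 'rV[R]_N) : Prop :=
  (forall i, ineq P z 0 i <= 0) /\ eqc P z = 0.

Definition stationary N M K (P : nlp N M K) (z : 'rV[R]_N) : Prop :=
  feasible P z /\
  exists (lam : 'rV[R]_M) (mu : 'rV[R]_K),
    [/\ forall i, 0 <= lam 0 i,
        forall i, lam 0 i * ineq P z 0 i = 0 &
        grad (obj P) z
        + \sum_(i < M) lam 0 i *: grad (component (ineq P) i) z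
        + \sum_(j < K) mu 0 j *: grad (component (eqc P) j) z = 0].

End NonlinearPrograms.

Section SparseOptimization.
Context {R : realType} {n m q : nat}.

Definition penalty (rho : R) (p : R -> R) : Prop :=
  [/\ convex_function (E := R^o) [set: R]%classic p,
      exists s : R, [/\ 0 < s, forall t, t != s -> p s < p t & p 0 - p s = rho],
      forall t : R, derivable p t 1 &
      continuous (derive1 p)].

Definition hadamard (x y : 'rV[R]_n) : 'rV[R]_n := \row_i (x 0 i * y 0 i).

Definition dot (x y : 'rV[R]_n) : R := \sum_(i < n) x 0 i * y 0 i.

Definition penalty_sum (p : 'I_n -> R -> R) (y : 'rV[R]_n) : R :=
  \sum_(i < n) p i (y 0 i).

(* A pair (x, y) is encoded as z = row_mx x y, so x = lsubmx z, y = rsubmx z. *)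
Definition spo_ineq (g : 'rV[R]_n -> 'rV[R]_m) (z : 'rV[R]_(n + n)) :
    'rV[R]_(m + n + n) :=
  row_mx (row_mx (g (lsubmx z)) (- lsubmx z)) (- rsubmx z).

Definition SPOcp (f : 'rV[R]_n -> R) (g : 'rV[R]_n -> 'rV[R]_m)
    (h : 'rV[R]_n -> 'rV[R]_q) (p : 'I_n -> R -> R) :
    nlp (n + n) (m + n + n) (q + n) :=
  {| obj := fun z => f (lsubmx z) + penalty_sum p (rsubmx z);
     ineq := spo_ineq g;
     eqc := fun z => row_mx (h (lsubmx z)) (hadamard (lsubmx z) (rsubmx z)) |}.

Definition Pen (f : 'rV[R]_n -> R) (g : 'rV[R]_n -> 'rV[R]_m)
    (h : 'rV[R]_n -> 'rV[R]_q) (p : 'I_n -> R -> R) (alpha : R) :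
    nlp (n + n) (m + n + n) q :=
  {| obj := fun z => f (lsubmx z) + penalty_sum p (rsubmx z)
                     + alpha * dot (lsubmx z) (rsubmx z);
     ineq := spo_ineq g;
     eqc := fun z => h (lsubmx z) |}.

Definition I_0 (x : 'rV[R]_n) : {set 'I_n} := finset (fun i => x 0 i == 0).

Definition I_g (g : 'rV[R]_n -> 'rV[R]_m) (x : 'rV[R]_n) : {set 'I_m} :=
  finset (fun i => g x 0 i == 0).

Definition SP_MFCQ (g : 'rV[R]_n -> 'rV[R]_m) (h : 'rV[R]_n -> 'rV[R]_q)
    (x : 'rV[R]_n) : Prop :=
  forall (lam : 'rV[R]_m) (mu : 'rV[R]_q) (gam : 'rV[R]_n),
    (forall i, i \in I_g g x -> 0 <= lam 0 i) ->
    \sum_(i in I_g g x) lam 0 i *: grad (component g i) x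
      + \sum_(j < q) mu 0 j *: grad (component h j) x
      + \sum_(i in I_0 x) gam 0 i *: delta_mx 0 i = 0 ->
    [/\ forall i, i \in I_g g x -> lam 0 i = 0,
        forall j, mu 0 j = 0 &
        forall i, i \in I_0 x -> gam 0 i = 0].

End SparseOptimization.

(* Main.v *)
Require Import Defs.
From mathcomp Require Import all_boot all_order all_algebra.
From mathcomp Require Import all_classical all_reals all_analysis.
From mathcomp Require Import lra ring.

Import Order.TTheory GRing.Theory Num.Theory.
Import numFieldNormedType.Exports.
Local Open Scope ring_scope.

(** The KKT system of (Pen(alpha)) is that of (SPOcp) with all multipliers of
    the constraints x_i y_i = 0 set to alpha ([split_kkt]).  Hence a stationary
    point (x, y) of (Pen(alpha)) is stationary for (SPOcp) as soon as
    x_i y_i = 0 for every i, and this is what has to be shown when (x, y) is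
    close to (xs, ys) and alpha is large.

    At (xs, ys) each index is of one of two kinds
    ([spo_stationary_dichotomy]).  Indeed p_i'(0) < 0 by convexity and the drop
    p_i(0) - p_i(s_i) = rho > 0 ([penalty_slope0]), which rules out
    xs_i = ys_i = 0; so either xs_i > 0 and ys_i = 0, or xs_i = 0 and ys_i > 0.

    - If xs_i > 0, then x_i stays above xs_i / 2 and p_i'(y_i) above
      p_i'(0) - 1.  For large alpha the multiplier
      nu_i = p_i'(y_i) + alpha x_i of y_i >= 0 is positive, so y_i = 0.

    - If xs_i = 0, then y_i stays above ys_i / 2 > 0.  Suppose x_i > 0; then
      the multiplier gam_i of x_i >= 0 vanishes.  The x-part of the KKT system
      reads
        grad f + sum lam_k grad g_k + sum mu_j grad h_j + (alpha y - gam) = 0.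
      Its multipliers satisfy the sign and support conditions of SP-MFCQ at xs:
      constraints of g inactive at xs stay inactive nearby, and by the first
      case alpha y - gam vanishes off I_0(xs).  SP-MFCQ makes the linear map
      from such multipliers to the combination of gradients bounded below,
      uniformly for x near xs ([sp_mfcq_bound], by compactness of the unit
      vectors of a closed cone).  So alpha y_i is at most a constant times
      |grad f x|, which fails for large alpha because y_i >= ys_i / 2. *)

(** * Row vectors in two blocks *)

Section RowBlocks.
Context {R : realType}.

Lemma sum_scale_delta a (v : 'rV[R]_a) : \sum_(i < a) v 0 i *: delta_mx 0 i = v.
Proof. by rewrite -row_sum_delta. Qed.

Lemma sum_row_mx a b c (F : 'I_c -> 'rV[R]_a) (G : 'I_c -> 'rV[R]_b) :
  \sum_i row_mx (F i) (G i) = row_mx (\sum_i F i) (\sum_i G i).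
Proof.
elim/big_rec3 : _ => [|i u v w _ ->]; first by rewrite row_mx0.
by rewrite add_row_mx.
Qed.

Lemma sum_row_mx0 a b c (F : 'I_c -> 'rV[R]_a) :
  \sum_i row_mx (F i) (0 : 'rV[R]_b) = row_mx (\sum_i F i) 0.
Proof. by rewrite sum_row_mx big1_eq. Qed.

Lemma sum_row_0mx a b c (G : 'I_c -> 'rV[R]_b) :
  \sum_i row_mx (0 : 'rV[R]_a) (G i) = row_mx 0 (\sum_i G i).
Proof. by rewrite sum_row_mx big1_eq. Qed.

Lemma delta_mx_lshift a b (i : 'I_a) :
  delta_mx 0 (lshift b i) = row_mx (delta_mx 0 i) 0 :> 'rV[R]_(a + b).
Proof.
apply/rowP => k; case: (split_ordP k) => j ->; rewrite ?row_mxEl ?row_mxEr !mxE.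
  by rewrite (inj_eq (@lshift_inj _ _)).
by rewrite eq_rlshift.
Qed.

Lemma delta_mx_rshift a b (i : 'I_b) :
  delta_mx 0 (rshift a i) = row_mx 0 (delta_mx 0 i) :> 'rV[R]_(a + b).
Proof.
apply/rowP => k; case: (split_ordP k) => j ->; rewrite ?row_mxEl ?row_mxEr !mxE.
  by rewrite eq_lrshift.
by rewrite (inj_eq (@rshift_inj _ _)).
Qed.

End RowBlocks.

(** * Gradients on a product space *)

(** The difference quotients of both sides agree term by term.  Applied to the
    two block projections and to the coordinates, this reduces every gradient on R^n x R^n to one on R^n or
    to a derivative on R. *)
Lemma derive_comp_linear {R : realType} {V W X : normedModType R}
    (L : V -> W) (F : W -> X) (a v : V) :
  linear L -> 'D_v (F \o L) a = 'D_(L v) F (L a).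
Proof.
move=> linL; rewrite /derive.
rewrite (_ : (fun h => _) = fun h => h^-1 *: ((F \o shift (L a)) (h *: L v) - F (L a))) //.
by apply/funext => h /=; rewrite linL.
Qed.

Lemma derivable_comp_linear {R : realType} {V W X : normedModType R}
    (L : V -> W) (F : W -> X) (a v : V) :
  linear L -> derivable F (L a) (L v) -> derivable (F \o L) a v.
Proof.
move=> linL; rewrite /derivable => dF.
rewrite (_ : (fun h => _) = fun h => h^-1 *: ((F \o shift (L a)) (h *: L v) - F (L a))) //.
by apply/funext => h /=; rewrite linL.
Qed.

Section ProductGradients.
Context {R : realType} {n : nat}.
Implicit Types (x y : 'rV[R]_n) (F : 'rV[R]_n -> R).

Lemma linear_lsubmx {a b} : linear (@lsubmx R 1 a b).
Proof. exact: linearP. Qed.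

Lemma linear_rsubmx {a b} : linear (@rsubmx R 1 a b).
Proof. exact: linearP. Qed.

Lemma linear_coord {a} (k : 'I_a) : linear (fun z : 'rV[R]_a => z 0 k : R).
Proof. by move=> c u v; rewrite !mxE. Qed.

Lemma derive_coord {a} (k : 'I_a) (P : R -> R) (z v : 'rV[R]_a) :
  'D_v (fun z : 'rV[R]_a => P (z 0 k)) z = 'D_(v 0 k) P (z 0 k).
Proof. exact: (derive_comp_linear _ P _ _ (linear_coord k)). Qed.

Lemma derive_dir0 {V W : normedModType R} (F : V -> W) a : 'D_0 F a = 0.
Proof.
rewrite /derive (_ : (fun _ => _) = cst 0) ?lim_cst//.
by apply/funext => h /=; rewrite scaler0 add0r subrr scaler0.
Qed.

Lemma grad_comp_lsubmx F x y :
  grad (fun z : 'rV[R]_(n + n) => F (lsubmx z)) (row_mx x y)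
  = row_mx (grad F x) 0.
Proof.
apply/rowP => k; rewrite [LHS]mxE (derive_comp_linear _ F _ _ linear_lsubmx).
rewrite row_mxKl; case: (split_ordP k) => j ->; rewrite ?row_mxEl ?row_mxEr !mxE.
  by congr ('D_ _ _ _); apply/rowP => i; rewrite !mxE (inj_eq (@lshift_inj _ _)).
rewrite -[RHS](derive_dir0 F x); congr ('D_ _ _ _).
by apply/rowP => i; rewrite !mxE eq_lrshift.
Qed.

Lemma grad_comp_rsubmx F x y :
  grad (fun z : 'rV[R]_(n + n) => F (rsubmx z)) (row_mx x y)
  = row_mx 0 (grad F y).
Proof.
apply/rowP => k; rewrite [LHS]mxE (derive_comp_linear _ F _ _ linear_rsubmx).
rewrite row_mxKr; case: (split_ordP k) => j ->; rewrite ?row_mxEl ?row_mxEr !mxE.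
  rewrite -[RHS](derive_dir0 F y); congr ('D_ _ _ _).
  by apply/rowP => i; rewrite !mxE eq_rlshift.
by congr ('D_ _ _ _); apply/rowP => i; rewrite !mxE (inj_eq (@rshift_inj _ _)).
Qed.

Lemma derivable_coord {a} (k : 'I_a) (z v : 'rV[R]_a) :
  derivable (fun z : 'rV[R]_a => z 0 k : R) z v.
Proof. exact: (derivable_comp_linear _ id _ _ (linear_coord k)). Qed.

Lemma grad_coordN {a} (k : 'I_a) (z : 'rV[R]_a) :
  grad (fun z : 'rV[R]_a => - z 0 k) z = - delta_mx 0 k.
Proof.
apply/rowP => j; rewrite !mxE (derive_coord k (@GRing.opp R)).
rewrite deriveN; last exact: derivable_id.
by rewrite derive_id !mxE eqxx eq_sym.
Qed.

Lemma grad_mul_coord {a} (k l : 'I_a) (z : 'rV[R]_a) :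
  grad (fun z : 'rV[R]_a => z 0 k * z 0 l) z
  = z 0 k *: delta_mx 0 l + z 0 l *: delta_mx 0 k.
Proof.
apply/rowP => j; rewrite !mxE deriveM; [|exact: derivable_coord..].
by rewrite !(derive_coord _ id) !derive_id !mxE eqxx /= ![_ == j]eq_sym.
Qed.

End ProductGradients.

(** * KKT conditions of both programs, block by block *)

Section SplitKKT.
Context {R : realType} {n m q : nat}.
Context (f : 'rV[R]_n -> R) (g : 'rV[R]_n -> 'rV[R]_m).
Context (h : 'rV[R]_n -> 'rV[R]_q) (p : 'I_n -> R -> R).
Implicit Types x y eta gam nu : 'rV[R]_n.

(** The common form of both KKT systems: gam and nu are the multipliers of
    x >= 0 and y >= 0, and eta weights the coupling terms x_i y_i.  In (SPOcp)
    eta is the free multiplier of the equality constraints x_i y_i = 0; in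
    (Pen(alpha)) it is the constant vector alpha. *)
Definition split_kkt eta x y : Prop :=
  [/\ forall i, g x 0 i <= 0, h x = 0, forall i, 0 <= x 0 i,
      forall i, 0 <= y 0 i &
  exists (lam : 'rV[R]_m) (mu : 'rV[R]_q) gam nu,
  [/\ forall i, 0 <= lam 0 i /\ lam 0 i * g x 0 i = 0,
      forall i, 0 <= gam 0 i /\ gam 0 i * x 0 i = 0,
      forall i, 0 <= nu 0 i /\ nu 0 i * y 0 i = 0,
      grad f x + \sum_(i < m) lam 0 i *: grad (component g i) x
        + \sum_(j < q) mu 0 j *: grad (component h j) x
        + hadamard eta y - gam = 0 &
      forall i, (p i)^`()%classic (y 0 i) + eta 0 i * x 0 i = nu 0 i]].

Lemma sum_grad_spo_ineq (lam : 'rV[R]_m) gam nu x y :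
  \sum_k row_mx (row_mx lam gam) nu 0 k
    *: grad (component (spo_ineq g) k) (row_mx x y)
  = row_mx (\sum_i lam 0 i *: grad (component g i) x - gam) (- nu).
Proof.
have gE i : component (spo_ineq g) (lshift n (lshift n i))
    = fun z => component g i (lsubmx z).
  by apply/funext => z; rewrite /component /spo_ineq !row_mxEl.
have xE i : component (spo_ineq g) (lshift n (rshift m i))
    = fun z => - z 0 (lshift n i).
  by apply/funext => z; rewrite /component /spo_ineq row_mxEl row_mxEr !mxE.
have yE i : component (spo_ineq g) (rshift (m + n) i)
    = fun z => - z 0 (rshift n i).
  by apply/funext => z; rewrite /component /spo_ineq row_mxEr !mxE.
have -> : row_mx (\sum_i lam 0 i *: grad (component g i) x - gam) (- nu)
    = row_mx (\sum_i lam 0 i *: grad (component g i) x) 0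
      - row_mx gam 0 - row_mx 0 nu.
  by rewrite !opp_row_mx !add_row_mx !oppr0 !addr0 add0r.
rewrite !big_split_ord /=; congr (_ + _ + _).
- rewrite -sum_row_mx0; apply: eq_bigr => i _.
  by rewrite !row_mxEl gE grad_comp_lsubmx scale_row_mx scaler0.
- rewrite -[gam in RHS]sum_scale_delta -sum_row_mx0 -sumrN; apply: eq_bigr => i _.
  rewrite row_mxEl row_mxEr xE grad_coordN delta_mx_lshift.
  by rewrite scalerN scale_row_mx scaler0.
- rewrite -[nu in RHS]sum_scale_delta -sum_row_0mx -sumrN; apply: eq_bigr => i _.
  by rewrite row_mxEr yE grad_coordN delta_mx_rshift scalerN scale_row_mx scaler0.
Qed.

Lemma grad_hadamard x y i :
  grad (fun z : 'rV[R]_(n + n) => hadamard (lsubmx z) (rsubmx z) 0 i)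
    (row_mx x y)
  = row_mx (y 0 i *: delta_mx 0 i) (x 0 i *: delta_mx 0 i).
Proof.
have -> : (fun z : 'rV[R]_(n + n) => hadamard (lsubmx z) (rsubmx z) 0 i)
    = fun z => z 0 (lshift n i) * z 0 (rshift n i).
  by apply/funext => z; rewrite !mxE.
rewrite grad_mul_coord row_mxEl row_mxEr delta_mx_lshift delta_mx_rshift.
by rewrite !scale_row_mx !scaler0 add_row_mx addr0 add0r.
Qed.

Lemma sum_scale_hadamard_delta eta y :
  \sum_i eta 0 i *: (y 0 i *: delta_mx 0 i) = hadamard eta y.
Proof.
rewrite -[RHS]sum_scale_delta; apply: eq_bigr => i _.
by rewrite scalerA mxE.
Qed.

Lemma sum_grad_spo_eqc (mu : 'rV[R]_q) eta x y :
  \sum_k row_mx mu eta 0 k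
    *: grad (component (eqc (SPOcp f g h p)) k) (row_mx x y)
  = row_mx (\sum_j mu 0 j *: grad (component h j) x + hadamard eta y)
      (hadamard eta x).
Proof.
have hE j : component (eqc (SPOcp f g h p)) (lshift n j)
    = fun z => component h j (lsubmx z).
  by apply/funext => z; rewrite /component /= row_mxEl.
have cE i : component (eqc (SPOcp f g h p)) (rshift q i)
    = fun z => hadamard (lsubmx z) (rsubmx z) 0 i.
  by apply/funext => z; rewrite /component /= row_mxEr.
rewrite big_split_ord /= -[hadamard eta x]add0r -add_row_mx; congr (_ + _).
  rewrite -sum_row_mx0; apply: eq_bigr => j _.
  by rewrite row_mxEl hE grad_comp_lsubmx scale_row_mx scaler0.
rewrite -!sum_scale_hadamard_delta -sum_row_mx; apply: eq_bigr => i _.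
by rewrite row_mxEr cE grad_hadamard scale_row_mx.
Qed.

Lemma sum_grad_pen_eqc (mu : 'rV[R]_q) alpha x y :
  \sum_k mu 0 k *: grad (component (eqc (Pen f g h p alpha)) k) (row_mx x y)
  = row_mx (\sum_j mu 0 j *: grad (component h j) x) 0.
Proof.
rewrite -sum_row_mx0; apply: eq_bigr => j _.
have -> : component (eqc (Pen f g h p alpha)) j
    = fun z => component h j (lsubmx z) by [].
by rewrite grad_comp_lsubmx scale_row_mx scaler0.
Qed.

Context (f_diff : forall x, differentiable f x).
Context (p_derivable : forall i t, derivable (p i) t 1).

Let derivable_p_coord i (y v : 'rV[R]_n) :
  derivable (fun y : 'rV[R]_n => p i (y 0 i)) y v.
Proof.
apply: (derivable_comp_linear _ (p i) _ _ (linear_coord i)).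
exact/diff_derivable/derivable1_diffP.
Qed.

Lemma penalty_sumE : penalty_sum p = \sum_i (fun y : 'rV[R]_n => p i (y 0 i)).
Proof. by apply/funext => y; rewrite fct_sumE. Qed.

Lemma derivable_penalty_sum y v : derivable (penalty_sum p) y v.
Proof. by rewrite penalty_sumE; apply: derivable_sum. Qed.

Lemma grad_penalty_sum y :
  grad (penalty_sum p) y = \row_i (p i)^`()%classic (y 0 i).
Proof.
apply/rowP => j; rewrite !mxE penalty_sumE derive_sum// (bigD1 j)//=.
rewrite big1 ?addr0 => [|i ij]; rewrite (derive_coord _ (p _)) mxE eqxx /=.
  by rewrite eqxx derive1E.
by rewrite (negbTE ij) derive_dir0.
Qed.

Let derivable_obj z v :
  derivable (fun z : 'rV[R]_(n + n) => f (lsubmx z)) z v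
  /\ derivable (fun z : 'rV[R]_(n + n) => penalty_sum p (rsubmx z)) z v.
Proof.
split.
  apply: (derivable_comp_linear _ f _ _ linear_lsubmx).
  exact/diff_derivable/f_diff.
apply: (derivable_comp_linear _ (penalty_sum p) _ _ linear_rsubmx).
exact: derivable_penalty_sum.
Qed.

Lemma grad_spo_obj x y :
  grad (obj (SPOcp f g h p)) (row_mx x y)
  = row_mx (grad f x) (\row_i (p i)^`()%classic (y 0 i)).
Proof.
rewrite -grad_penalty_sum -[grad f x]addr0 -[grad (penalty_sum p) y]add0r.
rewrite -add_row_mx -(grad_comp_lsubmx _ x y) -(grad_comp_rsubmx _ x y).
apply/rowP => k; rewrite !mxE /=.
by case: (derivable_obj (row_mx x y) (delta_mx 0 k)) => df dp; rewrite deriveD.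
Qed.

Lemma grad_pen_obj alpha x y :
  grad (obj (Pen f g h p alpha)) (row_mx x y)
  = row_mx (grad f x + alpha *: y)
      (\row_i ((p i)^`()%classic (y 0 i) + alpha * x 0 i)).
Proof.
pose c := fun i (z : 'rV[R]_(n + n)) => hadamard (lsubmx z) (rsubmx z) 0 i.
have dc i z v : derivable (c i) z v.
  have -> : c i = (fun z => z 0 (lshift n i) * z 0 (rshift n i)).
    by apply/funext => w; rewrite /c !mxE.
  by apply: derivableM; apply: derivable_coord.
transitivity (grad (obj (SPOcp f g h p)) (row_mx x y)
    + alpha *: \sum_i grad (c i) (row_mx x y)); last first.
  have -> : \sum_i grad (c i) (row_mx x y) = row_mx y x.
    rewrite -[in RHS](sum_scale_delta _ x) -[in RHS](sum_scale_delta _ y).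
    by rewrite -sum_row_mx; apply: eq_bigr => i _; rewrite grad_hadamard.
  rewrite grad_spo_obj scale_row_mx add_row_mx; congr row_mx.
  by apply/rowP => i; rewrite !mxE.
apply/rowP => k; rewrite !mxE summxE.
under eq_bigr do rewrite mxE.
have [df dp] := derivable_obj (row_mx x y) (delta_mx 0 k).
have -> : obj (Pen f g h p alpha)
    = obj (SPOcp f g h p) + alpha \*: \sum_i c i.
  apply/funext => z /=; congr (_ + _ * _).
  by rewrite fct_sumE; apply: eq_bigr => i _; rewrite /c !mxE.
rewrite deriveD ?deriveZ ?derive_sum//.
- exact: derivable_sum.
- exact: derivableD.
- by apply: derivableZ; apply: derivable_sum.
Qed.

Lemma spo_ineq_le0 x y :
  (forall k, spo_ineq g (row_mx x y) 0 k <= 0) <->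
  [/\ forall i, g x 0 i <= 0, forall i, 0 <= x 0 i & forall i, 0 <= y 0 i].
Proof.
rewrite /spo_ineq row_mxKl row_mxKr; split=> [le0|[gle0 xge0 yge0] k].
  split=> i.
  - by have := le0 (lshift n (lshift n i)); rewrite !row_mxEl.
  - by have := le0 (lshift n (rshift m i)); rewrite row_mxEl row_mxEr mxE oppr_le0.
  - by have := le0 (rshift (m + n) i); rewrite row_mxEr mxE oppr_le0.
case: (split_ordP k) => [k' ->|i ->].
  rewrite row_mxEl; case: (split_ordP k') => i ->.
    by rewrite row_mxEl.
  by rewrite row_mxEr mxE oppr_le0.
by rewrite row_mxEr mxE oppr_le0.
Qed.

Lemma spo_multiplierP (lam : 'rV[R]_m) gam nu x y :
  (forall k, 0 <= row_mx (row_mx lam gam) nu 0 k) /\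
  (forall k, row_mx (row_mx lam gam) nu 0 k * spo_ineq g (row_mx x y) 0 k = 0)
  <->
  [/\ forall i, 0 <= lam 0 i /\ lam 0 i * g x 0 i = 0,
      forall i, 0 <= gam 0 i /\ gam 0 i * x 0 i = 0 &
      forall i, 0 <= nu 0 i /\ nu 0 i * y 0 i = 0].
Proof.
rewrite /spo_ineq row_mxKl row_mxKr; split=> [[ge0 compl]|[lamP gamP nuP]].
  split=> i.
  - have := compl (lshift n (lshift n i)); have := ge0 (lshift n (lshift n i)).
    by rewrite !row_mxEl.
  - have := compl (lshift n (rshift m i)); have := ge0 (lshift n (rshift m i)).
    rewrite !row_mxEl !row_mxEr mxE mulrN => ? /eqP.
    by rewrite oppr_eq0 => /eqP.
  - have := compl (rshift (m + n) i); have := ge0 (rshift (m + n) i).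
    by rewrite !row_mxEr mxE mulrN => ? /eqP; rewrite oppr_eq0 => /eqP.
suff main k : 0 <= row_mx (row_mx lam gam) nu 0 k /\
    row_mx (row_mx lam gam) nu 0 k
      * row_mx (row_mx (g x) (- x)) (- y) 0 k = 0.
  by split=> k; have [] := main k.
case: (split_ordP k) => [k' ->|i ->].
  rewrite !row_mxEl; case: (split_ordP k') => i ->.
    by rewrite !row_mxEl.
  by rewrite !row_mxEr mxE mulrN; have [? ->] := gamP i; rewrite oppr0.
by rewrite !row_mxEr mxE mulrN; have [? ->] := nuP i; rewrite oppr0.
Qed.

Lemma kkt_rowP (w : 'rV[R]_n) eta nu x y :
  row_mx w (\row_i (p i)^`()%classic (y 0 i) + hadamard eta x - nu)
    = 0 :> 'rV[R]_(n + n) <->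
  w = 0 /\ forall i, (p i)^`()%classic (y 0 i) + eta 0 i * x 0 i = nu 0 i.
Proof.
rewrite -row_mx0; split=> [/eq_row_mx[-> E]|[-> E]].
  split=> // i; move/rowP/(_ i): E; rewrite !mxE => /eqP.
  by rewrite subr_eq0 => /eqP.
by congr row_mx; apply/rowP => i; rewrite !mxE E subrr.
Qed.

Lemma spo_stationaryP x y :
  stationary (SPOcp f g h p) (row_mx x y)
  <-> hadamard x y = 0 /\ exists eta, split_kkt eta x y.
Proof.
split=> [[[/spo_ineq_le0[gle0 xge0 yge0] /=]]|].
  rewrite row_mxKl row_mxKr -row_mx0 => /eq_row_mx[hx0 xy0] [l [e []]].
  rewrite -[l]hsubmxK -[lsubmx l]hsubmxK -[e]hsubmxK.
  set lam := lsubmx (lsubmx l); set gam := rsubmx (lsubmx l).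
  set nu := rsubmx l; set mu := lsubmx e; set eta := rsubmx e => ge0 compl.
  have /spo_multiplierP[lamP gamP nuP] := conj ge0 compl.
  rewrite grad_spo_obj sum_grad_spo_ineq (sum_grad_spo_eqc mu) addrAC.
  rewrite !add_row_mx => /kkt_rowP[Ex Ey].
  split=> //; exists eta; split=> //; exists lam, mu, gam, nu; split=> //.
  rewrite -[RHS]Ex addrA; congr (_ - _); rewrite -!addrA; congr (_ + _).
  by rewrite [LHS]addrC addrA.
case=> xy0 [eta [gle0 hx0 xge0 yge0]].
case=> lam [mu [gam [nu [lamP gamP nuP Ex Ey]]]].
have /spo_multiplierP[ge0 compl] := And3 lamP gamP nuP.
split; first split=> /=.
- exact/spo_ineq_le0.
- by rewrite row_mxKl row_mxKr hx0 xy0 row_mx0.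
exists (row_mx (row_mx lam gam) nu), (row_mx mu eta); split=> //.
rewrite grad_spo_obj sum_grad_spo_ineq sum_grad_spo_eqc addrAC !add_row_mx.
apply/kkt_rowP; split=> //.
rewrite -[RHS]Ex addrA; congr (_ - _); rewrite -!addrA; congr (_ + _).
by rewrite [RHS]addrC addrA.
Qed.

(** Differentiating the penalty term alpha x^T y yields what the constraints
    x_i y_i = 0 contribute when all their multipliers equal alpha. *)
Lemma pen_stationary_split alpha x y :
  stationary (Pen f g h p alpha) (row_mx x y) ->
  split_kkt (const_mx alpha) x y.
Proof.
case=> [[/spo_ineq_le0[gle0 xge0 yge0] /=]].
rewrite row_mxKl => hx0 [l [mu []]].
rewrite -[l]hsubmxK -[lsubmx l]hsubmxK.
set lam := lsubmx (lsubmx l); set gam := rsubmx (lsubmx l).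
set nu := rsubmx l => ge0 compl.
have /spo_multiplierP[lamP gamP nuP] := conj ge0 compl.
have hadE (z : 'rV[R]_n) : hadamard (const_mx alpha) z = alpha *: z.
  by apply/rowP => i; rewrite !mxE.
rewrite grad_pen_obj sum_grad_spo_ineq (sum_grad_pen_eqc mu alpha).
rewrite !add_row_mx addr0.
have -> : \row_i ((p i)^`()%classic (y 0 i) + alpha * x 0 i)
    = \row_i (p i)^`()%classic (y 0 i) + hadamard (const_mx alpha) x.
  by apply/rowP => i; rewrite !mxE.
move=> /kkt_rowP[Ex Ey].
split=> //; exists lam, mu, gam, nu; split=> //.
rewrite hadE -[RHS]Ex [RHS]addrAC addrA; congr (_ - _).
rewrite -!addrA; congr (_ + _); rewrite [RHS]addrA [RHS]addrC; congr (_ + _).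
exact: addrC.
Qed.

End SplitKKT.

(** * A matrix bounded below on a cone *)

Section ConeBound.
Context {R : realType}.

Lemma entry_le_mx_norm a b (A : 'M[R]_(a, b)) i j : `|A i j| <= `|A|.
Proof.
by rewrite [leRHS]/Num.Def.normr /= mx_normrE; apply/bigmax_geP; right => /=; exists (i, j).
Qed.

Lemma mulmx_norm_le k l (A : 'M[R]_(k, l)) (w : 'rV[R]_k) (e : R) :
  (forall i, `|row i A| <= e) -> `|w *m A| <= k%:R * e * `|w|.
Proof.
move=> Ae; rewrite mulmx_sum_row; apply: (le_trans (ler_norm_sum _ _ _)).
apply: (@le_trans _ _ (\sum_(i < k) e * `|w|)); last first.
  by rewrite sumr_const card_ord -[leLHS]mulr_natl mulrA.
by apply: ler_sum => i _; rewrite normrZ mulrC ler_pM// entry_le_mx_norm.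
Qed.

Lemma mulmx_continuous k l (A : 'M[R]_(k, l)) :
  continuous (fun w : 'rV[R]_k => w *m A).
Proof.
apply: (@bounded_linear_continuous _ _ _ (mulmxr A)).
apply/ex_bound; exists (k%:R * `|A|).
have le_row i : `|row i A| <= `|A|.
  rewrite [leLHS]/Num.Def.normr /= mx_normrE; apply/bigmax_leP; split=> // ij _.
  by rewrite mxE entry_le_mx_norm.
have := nbhs0_le (V := 'rV[R]_k) (@ltr01 R); apply: filterS => w w1 /=.
apply: (le_trans (mulmx_norm_le _ _ A w _ le_row)).
by rewrite ler_piMr// mulr_ge0.
Qed.

(** By homogeneity it is enough to bound |w A| below on the unit vectors of K;
    these form a compact set on which |w A| does not vanish. *)
Lemma cone_lower_bound k l (A : 'M[R]_(k, l)) (K : set 'rV[R]_k) :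
  closed K -> (forall (t : R) w, 0 < t -> K w -> K (t *: w)) ->
  (forall w, K w -> w *m A = 0 -> w = 0) ->
  exists2 c : R, 0 < c & forall w, K w -> c * `|w| <= `|w *m A|.
Proof.
move=> clK coneK kerK.
pose S := (K `&` [set w | `|w| = 1])%classic.
have normalize w : K w -> w != 0 -> S (`|w|^-1 *: w).
  move=> Kw w0; split; first by apply: coneK; rewrite // invr_gt0 normr_gt0.
  by rewrite /= normrZ normfV normr_id mulVf// normr_eq0.
have cS : compact S.
  apply: bounded_closed_compact.
    by exists 1; split=> // M M1 w [_ /= ->]; exact: ltW.
  apply: closedI => //.
  apply: (@preimage_closed _ _ (fun w : 'rV[R]_k => `|w|) [set 1 : R]%classic).
    by move=> w _; exact: norm_continuous.
  exact: closed_eq.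
have [S0|S0] := pselect (S !=set0)%classic; last first.
  exists 1 => // w Kw; have [->|w0] := eqVneq w 0; first by rewrite normr0 mulr0.
  by exfalso; apply: S0; exists (`|w|^-1 *: w); exact: normalize.
have /(EVT_min_rV S0 cS)[w0 /set_mem[Kw0 w01] minw0] :
    {within S, continuous (fun w : 'rV[R]_k => `|w *m A|)}%classic.
  apply: continuous_subspaceT => w; apply: continuous_comp.
    exact: mulmx_continuous.
  exact: norm_continuous.
exists `|w0 *m A|.
  rewrite normr_gt0; apply/eqP => /(kerK _ Kw0) w00.
  by move: w01; rewrite /= w00 normr0 => /esym/eqP; rewrite oner_eq0.
move=> w Kw; have [->|wn0] := eqVneq w 0; first by rewrite normr0 mulr0.
have := minw0 _ (mem_set (normalize _ Kw wn0)).
rewrite -scalemxAl normrZ normfV normr_id.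
by rewrite ler_pdivlMl ?normr_gt0// mulrC.
Qed.

(** The bound survives, with half the constant, as long as the rows of A move
    by at most c / (2 (k + 1)): the perturbation w (A x0 - A x) then has norm
    at most c / 2 |w|. *)
Lemma cone_lower_bound_near (T : topologicalType) k l (A : T -> 'M[R]_(k, l))
    (x0 : T) (K : set 'rV[R]_k) :
  (forall i, row i (A x) @[x --> x0] --> row i (A x0))%classic ->
  closed K -> (forall (t : R) w, 0 < t -> K w -> K (t *: w)) ->
  (forall w, K w -> w *m A x0 = 0 -> w = 0) ->
  exists2 c : R, 0 < c &
    \forall x \near x0, forall w, K w -> c * `|w| <= `|w *m A x|.
Proof.
move=> cA clK coneK kerK.
have [c c0 cP] := cone_lower_bound _ _ (A x0) _ clK coneK kerK.
exists (c / 2); first by rewrite divr_gt0.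
pose e : R := c / (2 * k.+1%:R).
have e0 : 0 < e by rewrite divr_gt0// mulr_gt0.
have near_rows : \forall x \near x0, forall i, `|row i (A x0 - A x)| <= e.
  apply: filter_forall => i.
  have /cvgr_dist_le/(_ _ e0) := cA i.
  by apply: filterS => x; rewrite linearB.
apply: filterS near_rows => x le_e w Kw.
have := mulmx_norm_le _ _ _ w _ le_e.
have ke : k%:R * e <= c / 2.
  rewrite /e invfM [c * _]mulrA mulrCA ler_piMr ?divr_ge0 ?ltW//.
  by rewrite ltr_pdivrMr ?ltr0n// mul1r ltr_nat.
move=> /le_trans/(_ (ler_wpM2r (normr_ge0 w) ke)) diff.
have := cP _ Kw.
have : `|w *m A x0| <= `|w *m A x| + `|w *m (A x0 - A x)|.
  by rewrite -[X in `|X| <= _](subrK (w *m A x)) mulmxBr addrC ler_normD.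
lra.
Qed.

End ConeBound.

(** * The slope of a penalty function at the origin *)

Section Penalty.
Context {R : realType}.

Lemma convex_below_chord (p : R -> R) (s h : R) :
  convex_function (E := R^o) [set: R]%classic p -> 0 <= h <= s -> 0 < s ->
  s * p h <= s * p 0 + h * (p s - p 0).
Proof.
move=> cvx /andP[h0 hs] s0.
have t0 : 0 <= h / s by rewrite divr_ge0// ltW.
have t1 : h / s <= 1 by rewrite ler_pdivrMr// mul1r.
have := cvx (Itv01 t0 t1) s 0 (mem_set I) (mem_set I).
have sn0 : s != 0 by rewrite gt_eqF.
rewrite convRE /=; set a := (X in p X).
have -> : a = h.
  by rewrite -[a]/(h / s * s + (1 - h / s) * 0) mulr0 addr0 divfK.
rewrite /unstable.onem => le_ph.
have := ler_wpM2l (ltW s0) le_ph.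
have -> : s * (h / s * p s + (1 - h / s) * p 0) = s * p 0 + h * (p s - p 0).
  by field.
by [].
Qed.

(** On [0, s] the graph of p lies below its chord, whose slope is - rho / s, so
    the right difference quotients at 0 are at most - rho / s. *)
Lemma penalty_slope0 (rho : R) (p : R -> R) :
  0 < rho -> penalty rho p -> p^`()%classic 0 < 0.
Proof.
move=> rho0 [cvx [s [s0 _ drop]] dp _].
apply: (@le_lt_trans _ _ (- rho / s)); last first.
  by rewrite mulNr oppr_lt0 divr_gt0.
rewrite derive1E ['D_1 p 0]cvg_at_rightE; last exact: dp.
apply: limr_le.
  have dp0 := dp 0.
  rewrite -(cvg_at_rightE (fun h : R => h^-1 *: ((p \o shift 0) _ - p 0))) //.
  apply: cvg_trans dp0; apply: cvg_app.
  move=> A [e egt0 Ae]; exists e => // x xe xgt0; apply: Ae => //.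
  exact/lt0r_neq0.
near=> h.
have h0 : 0 < h by near: h; exact: nbhs_right_gt.
have hs : h <= s by near: h; exact: nbhs_right_le.
rewrite /= addr0 [_%:A]mulr1 /GRing.scale /= mulrC.
rewrite ler_pdivrMr// mulrAC ler_pdivlMr//.
have := convex_below_chord p s h cvx _ s0; rewrite (ltW h0) hs => /(_ isT).
by have -> : p s - p 0 = - rho by [lra]; lra.
Unshelve. all: by end_near. Qed.

End Penalty.

(** * SP-MFCQ bounds the multipliers near the reference point *)

Section SparseMFCQ.
Context {R : realType} {n m q : nat}.
Context (g : 'rV[R]_n -> 'rV[R]_m) (h : 'rV[R]_n -> 'rV[R]_q) (xs : 'rV[R]_n).

Definition constraint_jacobian (x : 'rV[R]_n) : 'M[R]_(m + q + n, n) :=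
  col_mx (col_mx (\matrix_i grad (component g i) x)
                 (\matrix_j grad (component h j) x)) 1%:M.

Lemma mul_constraint_jacobian (lam : 'rV[R]_m) (mu : 'rV[R]_q) gam x :
  row_mx (row_mx lam mu) gam *m constraint_jacobian x
  = \sum_(i < m) lam 0 i *: grad (component g i) x
    + \sum_(j < q) mu 0 j *: grad (component h j) x + gam.
Proof.
rewrite !mul_row_col mulmx1 !mulmx_sum_row; congr (_ + _ + _);
  by apply: eq_bigr => i _; rewrite rowK.
Qed.

(** SP-MFCQ says exactly that no nonzero element of this cone is annihilated by
    constraint_jacobian xs.  The index sets are frozen at xs, which makes the
    cone closed and independent of the point x at which gradients are taken. *)
Definition multiplier_cone : set 'rV[R]_(m + q + n) :=
  [set w | (forall i, 0 <= w 0 (lshift n (lshift q i))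
             /\ (i \notin I_g g xs -> w 0 (lshift n (lshift q i)) = 0))
           /\ forall i, i \notin I_0 xs -> w 0 (rshift (m + q) i) = 0]%classic.

Lemma multiplier_cone_closed : closed multiplier_cone.
Proof.
have clP k (D : set R) : closed D -> closed [set w : 'rV[R]_(m + q + n) | D (w 0 k)]%classic.
  by apply: preimage_closed => w _; exact: coord_continuous.
have -> : multiplier_cone =
  (\bigcap_i ([set w | 0 <= w 0%R (lshift n (lshift q i))] `&`
     \bigcap_(_ in [set _ : unit | i \notin I_g g xs])
        [set w | w 0%R (lshift n (lshift q i)) = 0]) `&`
   \bigcap_(i in [set i | i \notin I_0 xs])
     [set w | w 0%R (rshift (m + q) i) = 0%R])%classic.
  apply/seteqP; split=> w /=.
    by move=> [wg w0]; split=> // i _; have [? ?] := wg i; split=> // _ /=.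
  move=> [wg w0]; split=> // i; have [? wi] := wg i I; split=> // ni.
  exact: (wi tt).
apply: closedI.
  apply: closed_bigI => i _; apply: closedI.
    apply: (clP _ [set t : R | 0 <= t]%classic); exact: closed_ge.
  by apply: closed_bigI => _ _; apply: (clP _ [set 0]%classic); exact: closed_eq.
by apply: closed_bigI => i _; apply: (clP _ [set 0]%classic); exact: closed_eq.
Qed.

(** A quantitative SP-MFCQ, uniform near xs.  It is stated for gam only, because
    gam carries the values alpha y_i that have to stay bounded. *)
Lemma sp_mfcq_bound : C1_vec g -> C1_vec h -> SP_MFCQ g h xs ->
  exists2 c : R, 0 < c & \forall x \near xs,
    forall (lam : 'rV[R]_m) (mu : 'rV[R]_q) (gam : 'rV[R]_n),
    (forall i, 0 <= lam 0 i) ->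
    (forall i, i \notin I_g g xs -> lam 0 i = 0) ->
    (forall i, i \notin I_0 xs -> gam 0 i = 0) ->
    forall i, c * `|gam 0 i| <=
      `|\sum_(i < m) lam 0 i *: grad (component g i) x
        + \sum_(j < q) mu 0 j *: grad (component h j) x + gam|.
Proof.
move=> gC1 hC1 cq.
have [|||c c0 cP] := cone_lower_bound_near _ _ _ constraint_jacobian xs
    multiplier_cone _ multiplier_cone_closed.
- move=> k.
  have row_cvg (F : 'rV[R]_n -> 'rV[R]_n) :
      continuous F -> (forall x, row k (constraint_jacobian x) = F x) ->
      (row k (constraint_jacobian x) @[x --> xs]
        --> row k (constraint_jacobian xs))%classic.
    by move=> cF /funext E; rewrite E [row k _](congr1 (@^~ xs) E); exact: cF.
  case: (split_ordP k) row_cvg => [k' ->|i ->] row_cvg; last first.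
    apply: (row_cvg (cst (delta_mx 0 i))); first exact: cst_continuous.
    by move=> x; rewrite rowKd row1.
  case: (split_ordP k') row_cvg => i -> row_cvg.
    apply: (row_cvg _ (gC1 i).2) => x.
    by rewrite /constraint_jacobian rowKu rowKu rowK.
  apply: (row_cvg _ (hC1 i).2) => x.
  by rewrite /constraint_jacobian rowKu rowKd rowK.
- move=> t w t0 [wg w0]; split=> i; rewrite mxE.
    have [? wi] := wg i; split; first by rewrite mulr_ge0// ltW.
    by move=> /wi ->; rewrite mulr0.
  by move=> /w0 ->; rewrite mulr0.
- move=> w; rewrite -[w]hsubmxK -[lsubmx w]hsubmxK.
  set lam := lsubmx (lsubmx w); set mu := rsubmx (lsubmx w).
  set gam := rsubmx w => -[wg w0].
  have lamP i : 0 <= lam 0 i /\ (i \notin I_g g xs -> lam 0 i = 0).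
    by have := wg i; rewrite !row_mxEl.
  have gamP i : i \notin I_0 xs -> gam 0 i = 0.
    by have := w0 i; rewrite row_mxEr.
  rewrite mul_constraint_jacobian => E.
  have [] := cq lam mu gam (fun i _ => (lamP i).1).
    rewrite -[RHS]E -[gam in RHS]sum_scale_delta; congr (_ + _ + _).
      rewrite [RHS](bigID (mem (I_g g xs))) /= [X in _ = _ + X]big1 ?addr0//.
      by move=> i /(lamP i).2 ->; rewrite scale0r.
    rewrite [RHS](bigID (mem (I_0 xs))) /= [X in _ = _ + X]big1 ?addr0//.
    by move=> i /gamP ->; rewrite scale0r.
  move=> lam0 mu0 gam0.
  have -> : lam = 0.
    apply/rowP => i; rewrite [RHS]mxE.
    by have [/lam0|/(lamP i).2] := boolP (i \in I_g g xs).
  have -> : mu = 0 by apply/rowP => i; rewrite [RHS]mxE.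
  have -> : gam = 0.
    apply/rowP => i; rewrite [RHS]mxE.
    by have [/gam0|/gamP] := boolP (i \in I_0 xs).
  by rewrite !row_mx0.
exists c => //; apply: filterS cP => x cP lam mu gam lam0 lamP gamP i.
have := cP (row_mx (row_mx lam mu) gam); rewrite mul_constraint_jacobian.
move=> le_c; apply: le_trans (le_c _); last first.
  by split=> j; rewrite ?row_mxEl ?row_mxEr; [split=> // /lamP|move=> /gamP].
rewrite ler_pM2l// -(row_mxEr (row_mx lam mu)); exact: entry_le_mx_norm.
Qed.

End SparseMFCQ.

(** * Neighbourhoods of a pair *)

Section BlockContinuity.
Context {R : realType} {a b : nat}.

Lemma lsubmx_continuous : continuous (@lsubmx R 1 a b).
Proof.
move=> /= z A /nbhs_ballP[e e0 eA]; apply/nbhs_ballP; exists e => //= w [_ zw].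
by apply: eA; split=> // i j; rewrite !mxE; exact: zw.
Qed.

Lemma rsubmx_continuous : continuous (@rsubmx R 1 a b).
Proof.
move=> /= z A /nbhs_ballP[e e0 eA]; apply/nbhs_ballP; exists e => //= w [_ zw].
by apply: eA; split=> // i j; rewrite !mxE; exact: zw.
Qed.

Lemma nbhs_row_mx (x : 'rV[R]_a) (y : 'rV[R]_b) (A : set 'rV[R]_a)
    (B : set 'rV[R]_b) :
  nbhs x A -> nbhs y B ->
  nbhs (row_mx x y) [set z | A (lsubmx z) /\ B (rsubmx z)]%classic.
Proof.
move=> xA yB.
have xA' : nbhs (row_mx x y) (lsubmx @^-1` A)%classic.
  by apply: lsubmx_continuous; rewrite row_mxKl.
have yB' : nbhs (row_mx x y) (rsubmx @^-1` B)%classic.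
  by apply: rsubmx_continuous; rewrite row_mxKr.
exact: filterI xA' yB'.
Qed.

End BlockContinuity.

(** * Exactness of the penalty *)

Lemma scale_eventually_gt {R : realType} {I : finType} (b B : I -> R) :
  (forall i, 0 < b i) ->
  exists2 alphas, 0 < alphas &
    forall alpha, alphas <= alpha -> forall i, B i < alpha * b i.
Proof.
move=> b0.
have Bb i : 0 <= `|B i| / b i by rewrite divr_ge0// ltW.
exists (1 + \sum_i `|B i| / b i).
  by rewrite ltr_wpDr// sumr_ge0.
move=> alpha le_alpha i; rewrite -ltr_pdivrMr//.
apply: lt_le_trans le_alpha; rewrite (bigD1 i)//= addrCA.
apply: (@le_lt_trans _ _ (`|B i| / b i)).
  by rewrite ler_pM2r ?invr_gt0// ler_norm.
by rewrite ltrDl ltr_wpDr// sumr_ge0.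
Qed.

(** Stationary points of (SPOcp) are strictly complementary: if x_i = y_i = 0,
    the i-th KKT equation in y would give nu_i = p_i'(0) < 0. *)
Lemma spo_stationary_dichotomy {R : realType} {n m q : nat}
    (f : 'rV[R]_n -> R) (g : 'rV[R]_n -> 'rV[R]_m) (h : 'rV[R]_n -> 'rV[R]_q)
    (p : 'I_n -> R -> R) (eta x y : 'rV[R]_n) :
  (forall i, (p i)^`()%classic 0 < 0) -> hadamard x y = 0 ->
  split_kkt f g h p eta x y ->
  forall i, x 0 i = 0 /\ 0 < y 0 i \/ 0 < x 0 i /\ y 0 i = 0.
Proof.
move=> slope0 xy0 [_ _ xge0 yge0 [lam [mu [gam [nu [_ _ nuP _ Ey]]]]]] i.
have [x0|x0] := eqVneq (x 0 i) 0; last first.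
  right; split; first by rewrite lt_neqAle eq_sym x0 xge0.
  move/rowP/(_ i)/eqP: xy0; rewrite !mxE mulf_eq0 (negbTE x0) /=.
  by move/eqP.
left; split=> //; rewrite lt_neqAle yge0 andbT; apply/eqP => y0.
have := Ey i; rewrite -y0 x0 mulr0 addr0 => Enu.
by have := slope0 i; rewrite Enu ltNge (nuP i).1.
Qed.

Lemma near_ge_half {R : realType} {n} (xs : 'rV[R]_n) :
  \forall x \near xs, forall i, 0 < xs 0 i -> xs 0 i / 2 <= (x : 'rV[R]_n) 0 i.
Proof.
apply: (@filter_forall _ _ (fun i (x : 'rV[R]_n) =>
  0 < xs 0 i -> xs 0 i / 2 <= x 0 i) (nbhs xs)) => i.
have [xs0|_] := ltP 0 (xs 0 i); last by near=> x.
have near_i : \forall x \near xs, xs 0 i / 2 <= (x : 'rV[R]_n) 0 i.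
  apply: (@cvgr_ge _ _ (nbhs xs) _ (fun x : 'rV[R]_n => x 0 i) (xs 0 i)).
    exact: coord_continuous.
  lra.
near=> x; move=> _; near: x; exact: near_i.
Unshelve. all: by end_near. Qed.

Lemma near_inactive {R : realType} {n m} (g : 'rV[R]_n -> 'rV[R]_m)
    (xs : 'rV[R]_n) :
  C1_vec g -> (forall i, g xs 0 i <= 0) ->
  \forall x \near xs, forall i, i \notin I_g g xs -> g x 0 i < 0.
Proof.
move=> gC1 gle0.
apply: (@filter_forall _ _ (fun i x => i \notin I_g g xs -> g x 0 i < 0)
  (nbhs xs)) => i.
have [iI|iI] := boolP (i \in I_g g xs); first by near=> x.
have g0 : g xs 0 i < 0.
  by rewrite lt_neqAle gle0 andbT; move: iI; rewrite inE.
have near_i : \forall x \near xs, g x 0 i < 0.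
  apply: (@cvgr_lt _ _ (nbhs xs) _ (component g i) (g xs 0 i)) => //.
  exact: (differentiable_continuous ((gC1 i).1 xs)).
near=> x; move=> _; near: x; exact: near_i.
Unshelve. all: by end_near. Qed.

Lemma near_penalty_slope {R : realType} {n} (p : 'I_n -> R -> R) (ys : 'rV[R]_n) :
  (forall i, continuous (p i)^`()%classic) ->
  \forall y \near ys, forall i,
    (p i)^`()%classic (ys 0 i) - 1 < (p i)^`()%classic ((y : 'rV[R]_n) 0 i).
Proof.
move=> cp; apply: (@filter_forall _ _ (fun i (y : 'rV[R]_n) =>
  (p i)^`()%classic (ys 0 i) - 1 < (p i)^`()%classic (y 0 i)) (nbhs ys)) => i.
apply: (@cvgr_gt _ _ (nbhs ys) _ (fun y : 'rV[R]_n => (p i)^`()%classic (y 0 i))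
  ((p i)^`()%classic (ys 0 i))); last by lra.
exact: (cvg_comp _ _ (@coord_continuous R 1 n 0 i ys) (cp i _)).
Qed.

Theorem theorem6p5 (R : realType) (n m q : nat)
  (f : 'rV[R]_n -> R) (g : 'rV[R]_n -> 'rV[R]_m) (h : 'rV[R]_n -> 'rV[R]_q)
  (rho : R) (p : 'I_n -> R -> R) (xs ys : 'rV[R]_n)
  (f_C1 : C1 f) (g_C1 : C1_vec g) (h_C1 : C1_vec h)
  (rho_gt0 : 0 < rho) (p_pen : forall i, penalty rho (p i))
  (stat : stationary (SPOcp f g h p) (row_mx xs ys))
  (cq : SP_MFCQ g h xs) :
  exists2 alphas : R, 0 < alphas &
  exists2 U : set 'rV[R]_(n + n), nbhs (row_mx xs ys) U &
    forall alpha : R, alphas <= alpha ->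
    forall x y : 'rV[R]_n, U (row_mx x y) ->
      stationary (Pen f g h p alpha) (row_mx x y) ->
      stationary (SPOcp f g h p) (row_mx x y).
Proof.
have p_der i t : derivable (p i) t 1 by have [] := p_pen i.
have slope0 i : (p i)^`()%classic 0 < 0 by exact: penalty_slope0 (p_pen i).
have spoP := spo_stationaryP f g h p f_C1.1 p_der.
have /spoP[xys0 [etas kkts]] := stat.
have dich := spo_stationary_dichotomy _ _ _ _ _ _ _ slope0 xys0 kkts.
have [gles _ _ _ _] := kkts.
have [c c0 near_bound] := sp_mfcq_bound g h xs g_C1 h_C1 cq.
(* alpha b_i > B_i is the largeness that index i requires: where xs_i = 0 it
   contradicts the bound c alpha y_i <= |grad f x|, and where xs_i > 0 it
   makes the left-hand side of p_i'(y_i) + alpha x_i = nu_i positive *)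
pose b i := if xs 0 i == 0 then c * (ys 0 i / 2) else xs 0 i / 2.
pose B i := if xs 0 i == 0 then `|grad f xs| + 1 else 1 - (p i)^`()%classic 0.
have b0 i : 0 < b i.
  rewrite /b; case: (dich i) => [[-> y0]|[x0 _]].
    by rewrite eqxx mulr_gt0// divr_gt0.
  by rewrite gt_eqF// divr_gt0.
have [alphas alphas0 large] := scale_eventually_gt b B b0.
exists alphas => //.
have near_f : \forall x \near xs, `|grad f x| <= `|grad f xs| + 1.
  have := cvgr_norm_le _ (f_C1.2 xs); apply; lra.
have cp i : continuous (p i)^`()%classic by have [] := p_pen i.
refine (ex_intro2 _ _ _ (nbhs_row_mx _ _ _ _
  (filterI (near_ge_half xs)
    (filterI (near_inactive g xs g_C1 gles) (filterI near_f near_bound)))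
  (filterI (near_ge_half ys) (near_penalty_slope p ys cp))) _).
move=> alpha le_alpha; have big := large alpha le_alpha.
have alpha0 : 0 < alpha := lt_le_trans alphas0 le_alpha.
move=> x y []; rewrite row_mxKl row_mxKr.
move=> [xP [gP [fP bound]]] [yP slopeP] statP.
have kkt := pen_stationary_split f g h p f_C1.1 p_der alpha x y statP.
apply/spoP; split; last by exists (const_mx alpha).
have [gle0 hx0 xge0 yge0 [lam [mu [gam [nu [lamP gamP nuP Ex Ey]]]]]] := kkt.
(* where xs_i > 0, nu_i is positive, so y_i vanishes by complementarity *)
have x_pos_y0 i : xs 0 i != 0 -> 0 < x 0 i /\ y 0 i = 0.
  move=> xsn0; have xs0 : 0 < xs 0 i.
    by case: (dich i) => [[xs0 _]|[]//]; rewrite xs0 eqxx in xsn0.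
  have le_x := xP i xs0.
  have ys0 : ys 0 i = 0 by case: (dich i) => -[]// xs00; rewrite xs00 ltxx in xs0.
  split; first by lra.
  have := big i; rewrite /b /B (negbTE xsn0) => big_i.
  have slope := slopeP i; rewrite ys0 in slope.
  have nu0 : 0 < nu 0 i.
    rewrite -Ey mxE; have := ler_wpM2l (ltW alpha0) le_x; lra.
  have /eqP := (nuP i).2; rewrite mulf_eq0 gt_eqF//= => /eqP.
  exact.
apply/rowP => i; rewrite !mxE.
have [xs0|/x_pos_y0[_ ->]] := eqVneq (xs 0 i) 0; last by rewrite mulr0.
have [->|xn0] := eqVneq (x 0 i) 0; first by rewrite mul0r.
(* now xs_i = 0 < x_i, so that gam_i = 0 and the coefficient of e_i in the
   x-part of the KKT system is alpha y_i, which SP-MFCQ bounds *)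
exfalso.
have gam0 : gam 0 i = 0.
  by have /eqP := (gamP i).2; rewrite mulf_eq0 (negbTE xn0) orbF => /eqP.
have ys0 : 0 < ys 0 i.
  by case: (dich i) => [[]//|[]]; rewrite xs0 ltxx.
have le_y := yP i ys0.
have := big i; rewrite /b /B xs0 eqxx => big_i.
have := bound lam mu (hadamard (const_mx alpha) y - gam).
have -> : \sum_(i < m) lam 0 i *: grad (component g i) x
    + \sum_(j < q) mu 0 j *: grad (component h j) x
    + (hadamard (const_mx alpha) y - gam) = - grad f x.
  by apply/eqP; rewrite -subr_eq0 opprK addrC !addrA Ex.
rewrite normrN => boundx.
have contra := boundx _ _ _ i.
have {contra} : c * `|(hadamard (const_mx alpha) y - gam) 0 i| <= `|grad f x|.
  apply: contra.
  - by move=> k; have [] := lamP k.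
  - move=> k /gP g0.
    by have /eqP := (lamP k).2; rewrite mulf_eq0 (lt_eqF g0) orbF => /eqP.
  - move=> k; rewrite inE => /x_pos_y0[x0 y0]; rewrite !mxE y0 mulr0 add0r.
    have /eqP := (gamP k).2; rewrite mulf_eq0 (gt_eqF x0) orbF => /eqP ->.
    by rewrite oppr0.
rewrite !mxE gam0 subr0 => le_f.
have := ler_wpM2l (ltW (mulr_gt0 c0 alpha0)) le_y.
have := ler_wpM2l (ltW c0) (ler_norm (alpha * y 0 i)).
move: le_f fP big_i; lra.
Qed.
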